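(* Let $n \ge 1$, let $r$ be a positive integer, and let $h = \{ x \in \mathbb{R}^n : \sum_{i=1}^n c_i x_i = 1 \}$ be a hyperplane in $\mathbb{R}^n$ with real coefficients $c_1,\dots,c_n$, such that $w(h) > 1 - \frac{r}{n}$. Then (a) $|\{ i : c_i > 1 \}| \le r - 1$, and (b) $|\{ i : c_i \notin \mathbb{Z} \}| \le 2r^2 - 1$.
   Context: Let $Q^n = \{0,1\}^n$. For a nonzero point $x \in Q^n$ with exactly $t$ coordinates equal to $1$, its weight is $w(x) = \frac{1}{t\binom{n}{t}}$. For a set $S \subseteq \mathbb{R}^n$ avoiding the origin, its weight is $w(S) = \sum_{p \in S \cap Q^n} w(p)$. *)

(* Defs.v *)
From HB Require Import structures.
From mathcomp Require Import all_boot all_order all_algebra.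
From mathcomp Require Import all_classical all_reals.

Set Implicit Arguments.
Unset Strict Implicit.
Unset Printing Implicit Defensive.

Import Order.TTheory GRing.Theory Num.Theory.

Local Open Scope classical_set_scope.
Local Open Scope ring_scope.

Definition cube (R : realType) (n : nat) : set 'rV[R]_n :=
  [set x : 'rV[R]_n | forall i, x ord0 i = 0 \/ x ord0 i = 1].

(* Meant for nonzero points of the cube; the origin gets the junk value
   0^-1 = 0. *)
Definition point_weight (R : realType) (n : nat) (x : 'rV[R]_n) : R :=
  let t := #|[pred i | x ord0 i == 1]| in (t * 'C(n, t))%:R^-1.

(* Meant for sets avoiding the origin. The finitely supported sum is genuine
   since the cube is finite (finite_cube below). *)
Definition weight (R : realType) (n : nat) (S : set 'rV[R]_n) : R :=
  \sum_(p \in S `&` @cube R n) point_weight p.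

Definition hyperplane (R : realType) (n : nat) (c : 'rV[R]_n) : set 'rV[R]_n :=
  [set x : 'rV[R]_n | \sum_(i < n) c ord0 i * x ord0 i = 1].

Lemma hyperplane_avoids0 (R : realType) (n : nat) (c : 'rV[R]_n) :
  ~ hyperplane c 0.
Proof.
rewrite /hyperplane /= big1; last by move=> i _; rewrite mxE mulr0.
by move/esym/eqP; rewrite oner_eq0.
Qed.

Lemma finite_cube (R : realType) (n : nat) : finite_set (@cube R n).
Proof.
pose f (b : 'rV[bool]_n) : 'rV[R]_n := \row_i (b ord0 i)%:R.
apply: (@sub_finite_set _ _ (f @` setT)); last first.
  exact/finite_image/finite_finset.
move=> x xc; exists (\row_i (x ord0 i == 1)) => //.
apply/rowP => i; rewrite !mxE.
by case: (xc i) => ->; rewrite ?eqxx // eq_sym oner_eq0.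
Qed.

(* Main.v *)
(** Let [S_t] be the partial sums of the coefficients [c_i] taken in a random
    order. Since a given [t]-set is the set of the first [t] indices with
    probability [1 / 'C(n, t)], the weight of the hyperplane is the sum over [t]
    of [P(S_t = 1) / t]. Rotating the first [t] indices preserves [S_t], and by
    the cycle lemma at least one of the [t] rotations of a sequence with
    [S_t = 1] has all its earlier partial sums below [1]. Hence the weight is at
    most the probability that the first passage lands exactly on [1], which fails
    for the orders starting with some [c_i > 1]: this gives (a).
    The argument still works if one only looks at partial sums that are integers,
    and then it applies to each class of starting points modulo the integers. An
    order starting with a nonintegral [c_i] meets at least two classes, so that it
    contributes at most [1/2]; the weight is then at most [1 - m / (2 n)] with [m]
    nonintegral coefficients, so that [m < 2 r]. *)

Require Import Defs.
From mathcomp Require Import all_boot all_order all_algebra all_fingroup.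
From mathcomp Require Import all_classical all_reals.
From mathcomp Require Import zify ring lra.

Import Order.TTheory GRing.Theory Num.Theory.

Local Open Scope ring_scope.

(** * Partial sums, rotations and the cycle lemma *)

Definition psum {R : nmodType} (a : nat -> R) (j : nat) : R := \sum_(i < j) a i.

Definition rotate {T : Type} (t k : nat) (a : nat -> T) (i : nat) : T :=
  a ((i + k) %% t)%N.

(* Only the partial sums lying in [G] are watched. *)
Definition first_passage {R : realType} (G : {pred R}) (a : nat -> R) (t : nat) :=
  (psum a t == 1) && [forall j : 'I_t, (psum a j \in G) ==> (psum a j < 1)].

Lemma psum0 (R : nmodType) (a : nat -> R) : psum a 0 = 0.
Proof. by rewrite /psum big_ord0. Qed.

Lemma psumS (R : nmodType) (a : nat -> R) j : psum a j.+1 = psum a j + a j.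
Proof. by rewrite /psum big_ord_recr. Qed.

Lemma eq_psum (R : nmodType) (a b : nat -> R) t j :
  (forall i, (i < t)%N -> a i = b i) -> (j <= t)%N -> psum a j = psum b j.
Proof.
by move=> ab jt; apply: eq_bigr => i _; rewrite ab// (leq_trans (ltn_ord i)).
Qed.

(** Past the wrap, the rotated sum is the tail of [a] from [k] on plus a head of [a]. At [k + j = t]
    the head is empty and both formulas agree. *)
Lemma psum_rotate (R : zmodType) (a : nat -> R) t k j : (k < t)%N -> (j <= t)%N ->
  psum (rotate t k a) j = if (k + j <= t)%N then psum a (k + j) - psum a k
                          else psum a t - psum a k + psum a (k + j - t).
Proof.
move=> kt; elim: j => [|j IH] jt.
  by rewrite addn0 (ltnW kt) psum0 subrr.
rewrite psumS IH ?(ltnW jt)// /rotate addnS [(j + k)%N]addnC.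
have [lt|ge] := ltnP (k + j) t.
  by rewrite (ltnW lt) modn_small// psumS addrAC.
rewrite -(subnK ge) modnDr modn_small; last by lia.
case: ifPn => [le|_]; last by rewrite subSn ?leq_addl// addnK psumS addrA.
have -> : (k + j = t)%N by lia.
by rewrite subnn add0n subSn// subnn psumS psum0 add0r.
Qed.

Lemma eq_first_passage (R : realType) (G : {pred R}) (a b : nat -> R) t :
  (forall i, (i < t)%N -> a i = b i) ->
  first_passage G a t = first_passage G b t.
Proof.
move=> ab; rewrite /first_passage (@eq_psum _ a b t)//; congr (_ && _).
by apply: eq_forallb => j; rewrite (@eq_psum _ a b t) ?(ltnW (ltn_ord j))//.
Qed.

(** As [1] is watched, an earlier passage would be a watched sum that is not below [1]. *)
Lemma first_passage_uniq {R : realType} {G : {pred R}} {a : nat -> R} {t t'} :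
  1 \in G -> first_passage G a t -> first_passage G a t' -> t = t'.
Proof.
move=> G1.
have fpNlt u v : first_passage G a u -> first_passage G a v -> ~~ (u < v)%N.
  move=> /andP[/eqP u1 _] /andP[_ /forallP H]; apply/negP => uv.
  by have := H (Ordinal uv); rewrite /= u1 G1 ltxx.
move=> tf tf'; case: (ltngtP t t') => // lt.
  by have := fpNlt _ _ tf tf'; rewrite lt.
by have := fpNlt _ _ tf' tf; rewrite lt.
Qed.

(* A variant of the cycle lemma inside the class of [psum a b] modulo [G]:
   one starts at the first point of this class where the partial sums are
   maximal. *)
Lemma cycle_lemma {R : realType} {G : {pred R}} {a : nat -> R} {t} b :
  zmod_closed G -> 1 \in G -> psum a t = 1 -> (b < t)%N ->
  exists p : 'I_t, psum a p - psum a b \in G /\ first_passage G (rotate t p a) t.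
Proof.
move=> zG G1 at1 bt; have [G0 GB] := zG.
have [_ GD] := GRing.zmod_closedD zG.
pose C := [pred i : 'I_t | psum a i - psum a b \in G].
have Cb : C (Ordinal bt) by rewrite /= subrr.
case: (arg_maxP (fun i : 'I_t => psum a i) Cb) => M CM Mmax.
(* Maximality bounds the sums after the wrap only by [1]; taking the least maximiser [p] makes the
   bound strict. *)
pose P i := C i && (psum a i == psum a M).
have PM : P M by rewrite /P CM eqxx.
case: (arg_minnP (fun i : 'I_t => val i) PM) => p /andP[Cp /eqP pM] pmin.
exists p; split=> //; apply/andP; split.
  rewrite psum_rotate//; case: ifPn => pt.
    have -> : nat_of_ord p = 0%N by lia.
    by rewrite psum0 subr0 at1.
  by rewrite addnK subrK at1.
apply/forallP => j; apply/implyP; rewrite psum_rotate ?(ltnW (ltn_ord j))// at1.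
case: ifPn => [|]; last first.
  rewrite -ltnNge => tpj qG.
  have qt : (p + j - t < t)%N by have := ltn_ord p; have := ltn_ord j; lia.
  have qp : (p + j - t < p)%N by have := ltn_ord j; lia.
  have Cq : C (Ordinal qt).
    rewrite /=; have -> : psum a (p + j - t) - psum a b =
      (1 - psum a p + psum a (p + j - t)) - 1 + (psum a p - psum a b) by ring.
    by apply: GD => //; apply: GB.
  have := Mmax _ Cq; rewrite /= le_eqVlt => /orP[/eqP e|]; last by rewrite -pM; lra.
  by have := pmin (Ordinal qt); rewrite /P Cq /= e eqxx => /(_ isT); lia.
rewrite leq_eqVlt => /orP[/eqP pjt|pjt qG]; last first.
  have Cq : C (Ordinal pjt).
    rewrite /=; have -> : psum a (p + j) - psum a b =
      (psum a (p + j) - psum a p) + (psum a p - psum a b) by ring.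
    exact: GD.
  by have := Mmax _ Cq; rewrite /= -pM; lra.
(* Index [t] lies outside ['I_t] and is replaced by [0], whose partial sum differs by [1], an
   element of [G]. *)
rewrite pjt at1 => qG.
have t0 : (0 < t)%N by exact: leq_ltn_trans (leq0n b) bt.
have C0 : C (Ordinal t0).
  rewrite /= psum0; have -> : 0 - psum a b =
    (1 - psum a p) - 1 + (psum a p - psum a b) by ring.
  by apply: GD => //; apply: GB.
have := Mmax _ C0; rewrite /= psum0 -pM le_eqVlt => /orP[/eqP e|]; last by lra.
have := pmin (Ordinal t0); rewrite /P C0 /= psum0 -pM e eqxx => /(_ isT).
by have := ltn_ord j; lia.
Qed.

(** * Averages over permutations *)

(** List each set followed by its complement and match the lists position by position; equal
    cardinals align [A] with [B]. *)
Lemma perm_imset_eq {T : finType} {A B : {set T}} :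
  #|A| = #|B| -> exists u : {perm T}, (u @: A)%SET = B.
Proof.
move=> AB; pose e (C : {set T}) := enum C ++ enum (~: C)%SET.
have eU C : uniq (e C).
  rewrite cat_uniq !enum_uniq andbT /=; apply/hasPn => x.
  by rewrite !mem_enum inE.
have eT C x : x \in e C by rewrite mem_cat !mem_enum inE orbN.
have eS C : size (e C) = #|T| by rewrite size_cat -!cardE cardsC.
pose f x := nth x (e B) (index x (e A)).
have iB x : (index x (e A) < size (e B))%N by rewrite eS -(eS A) index_mem.
have f_inj : injective f.
  move=> x y; rewrite /f (set_nth_default y) // => /eqP.
  rewrite nth_uniq// => /eqP xy.
  by have := congr1 (nth x (e A)) xy; rewrite !nth_index ?eT.
exists (perm f_inj); apply/eqP; rewrite eqEcard card_imset; last exact: perm_inj.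
rewrite AB leqnn andbT; apply/fintype.subsetP => y /imsetP[x xA ->].
have xi : (index x (e A) < #|B|)%N.
  by rewrite index_cat mem_enum xA -AB cardE index_mem mem_enum.
by rewrite permE /f nth_cat -cardE xi -mem_enum mem_nth// -cardE.
Qed.

(* [\sum_s g (s @: B)] is the same for all [B] of cardinality [#|A|]: sum it over
   these [B]. *)
Lemma sum_perm_imset {R : pzSemiRingType} {T : finType} (g : {set T} -> R)
    (A : {set T}) :
  'C(#|T|, #|A|)%:R * (\sum_(s : {perm T}) g (s @: A)%SET) =
  ((#|T|)`!)%:R * (\sum_(B : {set T} | #|B| == #|A|) g B).
Proof.
have card_eq_perm (s : {perm T}) (B : {set T}) : #|(s @: B)%SET| = #|B|.
  by rewrite card_imset//; exact: perm_inj.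
transitivity (\sum_(B : {set T} | #|B| == #|A|) \sum_(s : {perm T}) g (s @: B)%SET).
  rewrite [RHS](eq_bigr (fun=> \sum_(s : {perm T}) g (s @: A)%SET)); last first.
    move=> B /eqP AB; have [u <-] := perm_imset_eq (esym AB).
    rewrite [RHS](reindex_inj (mulgI u)); apply: eq_bigr => s _.
    by rewrite -imset_comp; congr g; apply: eq_imset => x /=; rewrite permM.
  rewrite -card_draws mulr_natl -sumr_const; apply: eq_bigl => B.
  by rewrite inE.
have -> : (#|T|)`! = #|{perm T}|.
  rewrite -[in LHS]cardsT -card_perm; apply: eq_card => s; rewrite !inE.
  by apply/fintype.subsetP => x _; rewrite inE.
rewrite exchange_big /= mulr_natl -sumr_const; apply: eq_bigr => s _.
rewrite [RHS](reindex_inj (imset_inj (@perm_inj _ s))).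
by apply: eq_bigl => B; rewrite card_eq_perm.
Qed.

(** The first index of a random order is uniform: [sum_perm_imset] applied to a singleton. *)
Lemma sum_perm_point {R : pzSemiRingType} {n : nat} (psi : 'I_n.+1 -> R) :
  n.+1%:R * (\sum_(s : 'S_n.+1) psi (s ord0)) = (n.+1)`!%:R * \sum_i psi i.
Proof.
have := sum_perm_imset (fun B : {set 'I_n.+1} => \sum_(i in B) psi i) [set ord0]%SET.
rewrite card_ord cards1 bin1 => psiE; rewrite -[RHS]mulr1.
have -> : \sum_i psi i =
    \sum_(B : {set 'I_n.+1} | #|B| == 1%N) \sum_(i in B) psi i.
  rewrite (eq_bigl (fun B => B \in [set [set i]%SET | i : 'I_n.+1]%SET)); last first.
    by move=> B; apply/cards1P/imsetP => [[x ->]|[x _ ->]]; exists x.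
  rewrite big_imset/=; last by move=> x y _ _; exact: set1_inj.
  by apply: eq_big => [i|i _]; rewrite ?inE// big_set1.
rewrite mulr1 -psiE; congr (_ * _); apply: eq_bigr => s _.
by rewrite imset_set1 big_set1.
Qed.

(** * The weight as an average over orders *)

(** Cube points are indicator vectors of subsets, which turns the finitely supported sum into one
    over a finite type. *)
Lemma weightE (R : realType) (n : nat) (c : 'rV[R]_n) :
  weight (hyperplane c) = \sum_(B : {set 'I_n} | \sum_(i in B) c ord0 i == 1)
                             (#|B| * 'C(n, #|B|))%:R^-1.
Proof.
pose f (B : {set 'I_n}) : 'rV[R]_n := \row_i (i \in B)%:R.
have fB B i : (f B ord0 i == 1) = (i \in B).
  by rewrite mxE; case: (i \in B); rewrite ?eqxx // eq_sym oner_eq0.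
have f_inj : injective f.
  by move=> A B AB; apply/setP => i; rewrite -!fB AB.
rewrite /weight fsbig_mkcondl.
have -> : @cube R n = [set f B | B in [set` enum [set: {set 'I_n}]%SET]]%classic.
  apply/seteqP; split=> x /=; last first.
    by move=> [B _ <-] i; rewrite mxE; case: (i \in B); [right|left].
  move=> xc; exists [set i | x ord0 i == 1]%SET; first by rewrite mem_enum inE.
  apply/rowP => i; rewrite !mxE inE.
  by case: (xc i) => ->; rewrite ?eqxx // eq_sym oner_eq0.
rewrite fsbig_image; last by move=> A B _ _; exact: f_inj.
rewrite -fsbig_seq ?enum_uniq// big_enum/= [RHS]big_mkcond/=.
apply: eq_big => [B|B _]; first by rewrite inE.
have -> : (f B \in hyperplane c) = (\sum_(i in B) c ord0 i == 1).
  rewrite big_mkcond /= -(@asboolb (_ == 1)); apply/asbool_equiv_eq.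
  have -> : \sum_i (if i \in B then c ord0 i else 0) =
            \sum_i c ord0 i * f B ord0 i.
    by apply: eq_bigr => i _; rewrite mxE; case: ifP; rewrite ?mulr1 ?mulr0.
  by split=> /eqP.
rewrite /point_weight; case: ifP => // _.
by rewrite (eq_card (B := B))// => i; rewrite -topredE/= fB.
Qed.

Definition steps {R : Type} {n : nat} (c : 'I_n.+1 -> R) (s : 'S_n.+1) (i : nat) : R :=
  c (s (inord i)).

Lemma psum_steps (R : nmodType) n (c : 'I_n.+1 -> R) (s : 'S_n.+1) t :
  (t <= n.+1)%N ->
  psum (steps c s) t = \sum_(i in (s @: [set i : 'I_n.+1 | (i < t)%N])%SET) c i.
Proof.
move=> tn; rewrite big_imset /=; last by move=> x y _ _; exact: perm_inj.
rewrite /psum (big_ord_widen _ (steps c s) tn); apply: eq_big => [i|i _].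
  by rewrite inE.
by rewrite /steps inord_val.
Qed.

Lemma weight_permE (R : realType) (n : nat) (c : 'rV[R]_n.+1) :
  (n.+1)`!%:R * weight (hyperplane c) =
  \sum_(t < n.+1) \sum_(s : 'S_n.+1) (psum (steps (c ord0) s) t.+1 == 1)%:R / t.+1%:R.
Proof.
pose g (B : {set 'I_n.+1}) : R := (\sum_(i in B) c ord0 i == 1)%:R.
pose F (B : {set 'I_n.+1}) := g B * (#|B| * 'C(n.+1, #|B|))%:R^-1.
transitivity (\sum_(t < n.+1) (n.+1)`!%:R * \sum_(B : {set 'I_n.+1} | #|B| == t.+1) F B).
  rewrite -mulr_sumr weightE big_mkcond; congr (_ * _).
  under [RHS]eq_bigr do rewrite big_mkcond.
  rewrite exchange_big; apply: eq_bigr => B _ /=; rewrite -big_mkcond /= /F /g.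
  (* The empty set contributes [0] on the left by the convention [0^-1 = 0], and no [t.+1] matches
     it on the right. *)
  have [->|B0] := eqVneq #|B| 0%N.
    by rewrite mul0n invr0 mulr0 [RHS]big1// if_same.
  have Bn : (#|B|.-1 < n.+1)%N.
    have : (#|B| <= n.+1)%N by rewrite -[leqRHS]card_ord max_card.
    by case: #|B| B0.
  rewrite [RHS](big_pred1 (Ordinal Bn)) => [|t /=].
    by case: ifP => _; rewrite ?mul1r ?mul0r.
  by rewrite -val_eqE/=; case: #|B| B0 => // m _; rewrite eqSS eq_sym.
apply: eq_bigr => t _.
pose A := [set i : 'I_n.+1 | (i < t.+1)%N]%SET.
have cA : #|A| = t.+1.
  rewrite -sum1_card -[RHS]card_ord -sum1_card.
  rewrite [RHS](big_ord_widen n.+1 (fun=> 1%N))//.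
  by apply: eq_bigl => i; rewrite inE.
have Cn0 : 'C(n.+1, t.+1)%:R != 0 :> R by rewrite pnatr_eq0 -lt0n bin_gt0.
rewrite -mulr_suml; apply: (mulfI Cn0).
rewrite [RHS]mulrA (eq_bigr (fun s : 'S_n.+1 => g (s @: A)%SET)); last first.
  by move=> s _; rewrite psum_steps.
have := sum_perm_imset g A; rewrite card_ord cA => ->.
rewrite mulrCA -mulrA; congr (_ * _); rewrite mulr_sumr mulr_suml.
apply: eq_bigr => B /eqP cB; rewrite /F cB natrM invfM.
by rewrite mulrCA; congr (_ * _); rewrite mulrCA mulfV// mulr1.
Qed.

(** * Averaging over rotations *)

(** Makes the rotation of the first [t] positions, the others fixed, a permutation by which orders
    can be reindexed. *)
Lemma rotate_ord_inj n t k : (t <= n.+1)%N ->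
  injective (fun i : 'I_n.+1 => if (i < t)%N then inord ((i + k) %% t) else i).
Proof.
move=> tn i j.
have lt_t (l : 'I_n.+1) : (l < t)%N -> ((l + k) %% t < t)%N.
  by move=> lt; rewrite ltn_mod (leq_ltn_trans _ lt).
have inordE (l : 'I_n.+1) : (l < t)%N ->
    nat_of_ord (inord ((l + k) %% t) : 'I_n.+1) = ((l + k) %% t)%N.
  by move=> lt; rewrite inordK// (leq_trans (lt_t _ lt)).
case: (ltnP i t) => [it|it]; case: (ltnP j t) => [jt|jt] //.
- move=> /(congr1 (@nat_of_ord _)); rewrite !inordE// => /eqP.
  by rewrite eqn_modDr !modn_small// => /eqP/val_inj.
- by move=> e; move: jt; rewrite leqNgt -e inordE// lt_t.
- by move=> e; move: it; rewrite leqNgt e inordE// lt_t.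
Qed.

Lemma steps_rotate (T : Type) n (c : 'I_n.+1 -> T) (s : 'S_n.+1) t k
    (tn : (t <= n.+1)%N) i :
  (i < t)%N ->
  steps c (perm (@rotate_ord_inj n t k tn) * s)%g i = rotate t k (steps c s) i.
Proof.
by move=> it; rewrite /steps /rotate permM permE inordK ?it// (leq_trans it).
Qed.

(** A start with step [x] is charged [psi x]; the last hypothesis asks that the rotations with a
    first passage collect at least [1] in total. Averaging over rotations, then over the first
    index, gives the bound. *)
Lemma weight_hyperplane_le {R : realType} {n : nat} (c : 'rV[R]_n.+1)
    (G : {pred R}) (psi : R -> R) :
  1 \in G -> (forall x, 0 <= psi x) ->
  (forall a t, psum a t.+1 = 1 ->
    1 <= \sum_(k < t.+1) psi (a k) * (first_passage G (rotate t.+1 k a) t.+1)%:R) ->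
  n.+1%:R * weight (hyperplane c) <= \sum_i psi (c ord0 i).
Proof.
move=> G1 psi0 psi1.
pose f t (s : 'S_n.+1) : R :=
  psi (c ord0 (s ord0)) * (first_passage G (steps (c ord0) s) t)%:R.
have f_rotate t k s (tn : (t <= n.+1)%N) : (k < t)%N ->
    f t (perm (@rotate_ord_inj n t k tn) * s)%g =
    psi (steps (c ord0) s k) * (first_passage G (rotate t k (steps (c ord0) s)) t)%:R.
  move=> kt; have t0 : (0 < t)%N by apply: leq_ltn_trans kt.
  rewrite /f; congr (psi _ * _).
    rewrite -[X in (_ * s)%g X](inord_val ord0) -[LHS]/(steps _ _ _).
    by rewrite steps_rotate// /rotate add0n modn_small.
  by congr (_%:R); congr nat_of_bool; apply: eq_first_passage => i; exact: steps_rotate.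
have sum_le t : (t < n.+1)%N ->
    \sum_(s : 'S_n.+1) (psum (steps (c ord0) s) t.+1 == 1)%:R / t.+1%:R <=
    \sum_(s : 'S_n.+1) f t.+1 s.
  move=> tn; rewrite -mulr_suml ler_pdivrMr ?ltr0n//.
  (* Each rotation permutes the orders, so every [k] yields the same sum over [s]. *)
  have -> : (\sum_s f t.+1 s) * t.+1%:R =
      \sum_(s : 'S_n.+1) \sum_(k < t.+1) f t.+1 (perm (@rotate_ord_inj n t.+1 k tn) * s)%g.
    rewrite exchange_big (eq_bigr (fun=> \sum_s f t.+1 s)) => [|k _].
      by rewrite sumr_const card_ord mulr_natr.
    by rewrite [RHS](reindex_inj (mulgI (perm (@rotate_ord_inj n t.+1 k tn)))).
  apply: ler_sum => s _; under eq_bigr do rewrite f_rotate//.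
  case: eqP => [/psi1 //|_]; apply: sumr_ge0 => k _.
  by rewrite mulr_ge0.
have sum_psi : (n.+1)`!%:R * weight (hyperplane c) <=
    \sum_(s : 'S_n.+1) psi (c ord0 (s ord0)).
  rewrite weight_permE.
  apply: (@le_trans _ _ (\sum_(t < n.+1) \sum_(s : 'S_n.+1) f t.+1 s)).
    by apply: ler_sum => t _; exact: sum_le.
  (* For a fixed order at most one [t] is a first passage, so the indicators sum to at most [1]. *)
  rewrite exchange_big; apply: ler_sum => s _; rewrite -mulr_sumr ler_piMr//.
  have [/existsP[t tf]|/existsPn nf] := boolP [exists t : 'I_n.+1,
      first_passage G (steps (c ord0) s) t.+1]; last first.
    by rewrite big1 ?ler01// => t _; rewrite (negbTE (nf t)).
  rewrite (bigD1 t)//= tf big1 ?addr0// => t' t't.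
  case t'f: (first_passage G _ t'.+1) => //; case/eqP: t't; apply: val_inj.
  by have [] := first_passage_uniq G1 t'f tf.
have n1_gt0 : 0 < (n.+1)`!%:R :> R by rewrite ltr0n fact_gt0.
rewrite -(ler_pM2l n1_gt0) mulrCA -(sum_perm_point (fun i => psi (c ord0 i))).
by rewrite ler_pM2l// ltr0n.
Qed.

(** * The bounds on large and on nonintegral coefficients *)

(** Equality occurs only for a passage in one step; otherwise the head is a watched partial sum. *)
Lemma first_passage_head_le1 {R : realType} {a : nat -> R} {t} :
  first_passage predT a t.+1 -> a 0%N <= 1.
Proof.
have psum1 : psum a 1 = a 0%N by rewrite psumS psum0 add0r.
case: t => [/andP[/eqP]|t /andP[_ /forallP]]; first by rewrite psum1 => ->.
by move=> /(_ (Ordinal (isT : 1 < t.+2)%N)) /=; rewrite psum1 => /ltW.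
Qed.

(** With every partial sum watched, the rotation from the cycle lemma starts with a step at most
    [1], so steps above [1] may be charged [0]. *)
Lemma weight_le_card_gt1 {R : realType} {n : nat} (c : 'rV[R]_n.+1) :
  n.+1%:R * weight (hyperplane c) <=
  n.+1%:R - #|[pred i : 'I_n.+1 | c ord0 i > 1]%R|%:R.
Proof.
have -> : n.+1%:R - #|[pred i : 'I_n.+1 | c ord0 i > 1]%R|%:R =
    \sum_i (c ord0 i <= 1)%R%:R :> R.
  have -> : n.+1%:R = \sum_(i < n.+1) 1 :> R by rewrite sumr_const card_ord.
  rewrite -sum1_card natr_sum [X in _ - X]big_mkcond/= -sumrB.
  by apply: eq_bigr => i _; rewrite !inE; case: ltP; rewrite ?subrr ?subr0.
apply: (weight_hyperplane_le c predT (fun x => (x <= 1)%R%:R)) => //.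
move=> a t at1.
have predT_zmod : zmod_closed (predT : {pred R}) by [].
have [p [_ pf]] := cycle_lemma 0 predT_zmod isT at1 isT.
rewrite (bigD1 p)//= pf mulr1.
have := first_passage_head_le1 pf; rewrite /rotate add0n modn_small// => ->.
by rewrite lerDl sumr_ge0// => k _; rewrite mulr_ge0.
Qed.

(** With only integral sums watched, a nonintegral first step of one good rotation leads to another
    class modulo the integers, which supplies a second good rotation; charging [1/2] to such steps
    then suffices. *)
Lemma weight_le_card_nonint {R : realType} {n : nat} (c : 'rV[R]_n.+1) :
  n.+1%:R * weight (hyperplane c) <=
  n.+1%:R - #|[pred i : 'I_n.+1 | c ord0 i \isn't a Num.int]%R|%:R / 2.
Proof.
pose psi (x : R) : R := if x \is a Num.int then 1 else 2^-1.
have -> : n.+1%:R - #|[pred i : 'I_n.+1 | c ord0 i \isn't a Num.int]%R|%:R / 2 =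
    \sum_i psi (c ord0 i).
  have -> : n.+1%:R = \sum_(i < n.+1) 1 :> R by rewrite sumr_const card_ord.
  rewrite -sum1_card natr_sum [X in _ - X / 2]big_mkcond/=.
  rewrite mulr_suml -sumrB; apply: eq_bigr => i _; rewrite !inE /psi.
  by case: (c ord0 i \is a Num.int) => /=; lra.
have psi_ge x : 2^-1 <= psi x by rewrite /psi; case: ifP => _; lra.
have psi_ge0 x : 0 <= psi x by apply: le_trans (psi_ge x); lra.
have Zint : zmod_closed (Num.int : {pred R}) by exact: int_num_subring.
have int1 : 1 \in (Num.int : {pred R}) by exact: rpred1.
apply: (weight_hyperplane_le c Num.int psi) => // a t at1.
have term_ge0 (k : 'I_t.+1) :
    0 <= psi (a k) * (first_passage Num.int (rotate t.+1 k a) t.+1)%:R.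
  by rewrite mulr_ge0.
have [p [pC pf]] := cycle_lemma 0 Zint int1 at1 isT.
rewrite psum0 subr0 in pC; rewrite (bigD1 p)//= pf mulr1 {1}/psi.
case: ifPn => ap; first by rewrite lerDl sumr_ge0.
have apE : a p = psum a p.+1 - psum a p by rewrite psumS addrC addKr.
(* If [p] were the last index, [a p] would be the difference of the integers [1] and [psum a p]. *)
have pt : (p.+1 < t.+1)%N.
  rewrite ltn_neqAle ltn_ord andbT; apply: contra ap => /eqP pt.
  by rewrite apE pt at1 rpredB.
have [q [qC qf]] := cycle_lemma p.+1 Zint int1 at1 pt.
(* The starts [p] and [q] lie in classes that differ by the nonintegral [a p]. *)
have qp : q != p.
  by apply: contra ap => /eqP qp; rewrite apE -opprB rpredN -{1}qp.
rewrite (bigD1 q)//= qf mulr1.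
have := psi_ge (a q); set S := \sum_(i | _) _.
have : 0 <= S by rewrite sumr_ge0.
by lra.
Qed.

Theorem theorem3p1 (R : realType) (n r : nat) (c : 'rV[R]_n)
    (n_ge1 : (1 <= n)%N) (r_gt0 : (0 < r)%N) (c_neq0 : c != 0)
    (weight_gt : weight (hyperplane c) > 1 - r%:R / n%:R) :
  (#|[pred i : 'I_n | c ord0 i > 1]%R| <= r - 1)%N /\
  (#|[pred i : 'I_n | c ord0 i \isn't a Num.int]%R| <= 2 * r ^ 2 - 1)%N.
Proof.
case: n n_ge1 c c_neq0 weight_gt => // n _ c _ weight_gt.
have n_gt0 : 0 < n.+1%:R :> R by rewrite ltr0n.
have w_gt : n.+1%:R - r%:R < n.+1%:R * weight (hyperplane c).
  move: weight_gt; rewrite -(ltr_pM2l n_gt0) mulrBr mulr1 mulrCA mulfV ?mulr1//.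
  by rewrite gt_eqF.
split.
  have : #|[pred i : 'I_n.+1 | c ord0 i > 1]%R|%:R < r%:R :> R.
    by have := weight_le_card_gt1 c; lra.
  by rewrite ltr_nat; lia.
(* The count is even below [2 * r], and [r <= r ^ 2]. *)
have : #|[pred i : 'I_n.+1 | c ord0 i \isn't a Num.int]%R|%:R < (2 * r)%:R :> R.
  by have := weight_le_card_nonint c; rewrite natrM; lra.
by rewrite ltr_nat; nia.
Qed.
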